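(* Let $(\boldsymbol{\nu},\mathbf{G},T)$ be an instance of Rising Graph-Triggered Bandits with $k$ arms such that $\mathbf{G}\in\mathbb{B}_{\widetilde k}$ is block-diagonal, with clique partition $\mathcal{C}_{\mathbf{G}}$ of $[k]$. Let $$C^*_{\boldsymbol{\nu},\mathbf{G},T}\in\operatorname*{arg\,max}_{C\in\mathcal{C}_{\mathbf{G}}}\ \sum_{t\in[T]}\max_{j\in C}\mu_j(t).$$ Then the policy given by $$\pi^*_{\boldsymbol{\nu},\mathbf{G},T}(t)\in\operatorname*{arg\,max}_{j\in C^*_{\boldsymbol{\nu},\mathbf{G},T}}\mu_j(t),\qquad \forall t\in[T],$$ is optimal, i.e. $\pi^*_{\boldsymbol{\nu},\mathbf{G},T}\in\operatorname*{arg\,max}_{\pi}J_{\boldsymbol{\nu},\mathbf{G},T}(\pi)$.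
   Context: Graph-Triggered Bandits (GTB): there are $k$ arms, a horizon $T\in\mathbb{N}$, and a symmetric connectivity matrix $\mathbf{G}\in\{0,1\}^{k\times k}$ with $\mathbf{G}_{i,i}=1$ for all $i\in[k]=\{1,\dots,k\}$. At each round $t\in[T]$ the policy $\pi$ selects an arm $I_t$ as a function of the past history of arms and rewards. The number of triggers of arm $i$ up to and including round $t$ is $\widetilde N_{i,t}=\sum_{\tau=1}^{t}\mathbf{1}\{\mathbf{G}_{I_\tau,i}=1\}$. Pulling $I_t$ yields a reward drawn from a distribution $\nu_{I_t,n}$ with $n=\widetilde N_{I_t,t}$, whose mean is $\mu_{I_t}(n)\in[0,1]$. The performance of $\pi$ is $J_{\boldsymbol{\nu},\mathbf{G},T}(\pi)=\mathbb{E}\big[\sum_{t=1}^T\mu_{I_t}(\widetilde N_{I_t,t})\big]$. Rising GTB: with $\gamma_i(n)=\mu_i(n+1)-\mu_i(n)$, for every arm $i$ and every $n$ one has $\gamma_i(n)\ge 0$ and $\gamma_i(n-1)\ge\gamma_i(n)$. Block-diagonal matrices: $\mathbb{B}_{\widetilde k}$ is the set of connectivity matrices whose diagonal blocks ($\widetilde k$ of them) are all-ones square matrices and whose off-diagonal blocks are zero; equivalently there is a partition $\mathcal{C}_{\mathbf{G}}$ of $[k]$ into $\widetilde k$ classes (cliques) with $\mathbf{G}_{i,j}=1$ if and only if $i,j$ lie in the same class. *)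

(* Defs.v *)
From HB Require Import structures.
From mathcomp Require Import all_boot all_order all_algebra.
From mathcomp Require Import all_classical all_reals all_analysis.
From mathcomp Require Import measurable_realfun.

Set Implicit Arguments.
Unset Strict Implicit.
Unset Printing Implicit Defensive.
Import Order.TTheory GRing.Theory Num.Theory.
Import numFieldNormedType.Exports.

Local Open Scope classical_set_scope.
Local Open Scope ring_scope.

Definition argmax {d} {X : Type} {Y : porderType d} (D : set X) (f : X -> Y) :
    set X :=
  [set x | D x /\ forall y, D y -> (f y <= f x)%O].

HB.instance Definition _ n := isPointed.Build 'I_n.+1 ord0.
HB.instance Definition _ n := @isMeasurable.Build default_measure_display
  'I_n.+1 discrete_measurable discrete_measurable0
  discrete_measurableC discrete_measurableU.

Section bind.
Local Open Scope ereal_scope.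
Context d1 d2 (X : measurableType d1) (Y : measurableType d2) (R : realType).
Variables (P : probability X R) (K : R.-pker X ~> Y).

(* The law of y when x ~ P and y ~ K x. *)
Definition kbind (A : set Y) : \bar R := \int[P]_x K x A.

Let kbind0 : kbind set0 = 0.
Proof. by apply: integral0_eq => x _; rewrite measure0. Qed.

Let kbind_ge0 A : 0 <= kbind A.
Proof. exact: integral_ge0. Qed.

Let kbind_sigma_additive : semi_sigma_additive kbind.
Proof.
move=> F mF tF mUF; rewrite [X in _ --> X](_ : _ =
    \int[P]_x (\sum_(0 <= n <oo) K x (F n))); last first.
  by apply: eq_integral => x _; rewrite measure_semi_bigcup.
apply/cvg_closeP; split.
  by apply: is_cvg_nneseries => n _ _; exact: integral_ge0.
rewrite closeE// integral_nneseries// => n.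
exact: measurable_kernel.
Qed.

HB.instance Definition _ := isMeasure.Build _ _ _ kbind
  kbind0 kbind_ge0 kbind_sigma_additive.

Let kbind_setT : kbind setT = 1.
Proof.
rewrite /kbind (eq_integral (cst 1)) => [|x _]; last exact: prob_kernel.
by rewrite integral_cst// mul1e; exact: probability_setT.
Qed.

HB.instance Definition _ := Measure_isProbability.Build _ _ _ kbind kbind_setT.

End bind.

Lemma measurable_discrete_choice d d' (X : measurableType d)
    (Y : measurableType d') (C : finType) (c : X -> C) (f : C -> X -> Y) :
  (forall a, measurable [set x | c x = a]) ->
  (forall a, measurable_fun setT (f a)) ->
  measurable_fun setT (fun x => f (c x) x).
Proof.
move=> mc mf _ B mB; rewrite setTI.
rewrite (_ : _ @^-1` _ = \bigcup_(a in [set: C])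
    ([set x | c x = a] `&` f a @^-1` B)); last first.
  apply/seteqP; split => [x Bx|x [a _ [<- //]]].
  by exists (c x).
apply: fin_bigcup_measurable => [|a _]; first exact: finite_finset.
by apply: measurableI => //; rewrite -[X in measurable X]setTI; exact: mf.
Qed.

Section graph_triggered_bandit.
Context {R : realType} {k : nat}.

(* There are k.+1 arms: the set of arms has to be nonempty. *)
Local Notation arm := 'I_k.+1.
Local Notation history t := (t.-tuple (arm * measurableTypeR R)).

(* nu i n is the law of the reward of arm i at its n-th trigger, n >= 1;
   nu i 0 is never sampled. *)
Variable nu : arm -> nat -> probability (measurableTypeR R) R.
Variable G : 'M[bool]_k.+1.

Definition mu (i : arm) (n : nat) : R := fine 'E_(nu i n)[id].

Definition gamma (i : arm) (n : nat) : R := mu i n.+1 - mu i n.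

Definition bounded_means : Prop := forall i n, (0 < n)%N ->
  (nu i n).-integrable setT (EFin \o id) /\ 0 <= mu i n <= 1.

Definition rising : Prop := forall i,
  (forall n, (0 < n)%N -> 0 <= gamma i n) /\
  (forall n, (1 < n)%N -> gamma i n <= gamma i n.-1).

Definition connectivity : Prop := G^T = G /\ forall i, G i i.

(* This is block-diagonality up to the numbering of the arms. *)
Definition clique_partition (CG : {set {set arm}}) : Prop :=
  finset.partition CG [set: arm]%SET /\
  forall i j, G i j = (finset.pblock CG i == finset.pblock CG j).

(* The number of triggers of arm i in the rounds 1, ..., t whose pulled arms
   are listed by s. *)
Definition triggers (s : seq arm) (i : arm) : nat :=
  (\sum_(j <- s) G j i)%N.

(* The arm pulled in round t.+1 depends on the first t arms and rewards. *)
Definition policy : Type := forall t, {mfun history t >-> arm}.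

Definition arms t (h : history t) : t.-tuple arm := [tuple of map fst h].

Definition extend t (a : arm) (h : history t) (x : measurableTypeR R) :
    history t.+1 :=
  [tuple of rcons h (a, x)].

Let measurable_uncurry_extend t a :
  measurable_fun setT (fun hx => @extend t a hx.1 hx.2).
Proof.
apply/measurable_fun_tnthP => i.
have [it|it] := ltnP i t.
  rewrite (_ : _ \o _ = (fun h => tnth h (Ordinal it)) \o fst); last first.
    apply/funext => -[h x] /=.
    by rewrite !(tnth_nth (a, x)) /= nth_rcons size_tuple it.
  by apply: measurableT_comp => //; exact: measurable_tnth.
rewrite (_ : _ \o _ = fun hx => (a, hx.2)); first exact: measurable_fun_pair.
apply/funext => -[h x] /=.
have iE : val i = t by apply/eqP; rewrite eqn_leq it -ltnS ltn_ord.
by rewrite (tnth_nth (a, x)) /= nth_rcons size_tuple iE ltnn eqxx.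
Qed.

Let measurable_extend t a h : measurable_fun setT (@extend t a h).
Proof. exact: measurable_fun_pair2 (measurable_uncurry_extend _). Qed.

HB.instance Definition _ t a h :=
  isMeasurableFun.Build _ _ _ _ (@extend t a h) (@measurable_extend t a h).

Section law.
Variable pi : policy.

(* The law of the history after round t.+1, given the history h after round
   t; the pull of round t.+1 itself counts in the trigger number. *)
Definition round_kernel t (h : history t) :
    {measure set history t.+1 -> \bar R} :=
  let a := pi t h in
  distribution (nu a (triggers (rcons (arms h) a) a)) (extend a h).

Let measurable_round t U : measurable U ->
  measurable_fun setT (@round_kernel t ^~ U).
Proof.
move=> mU.
pose f (sa : t.-tuple arm * arm) (h : history t) :=
  distribution (nu sa.2 (triggers (rcons sa.1 sa.2) sa.2)) (extend sa.2 h) U.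
apply: (@measurable_discrete_choice _ _ _ _ _ (fun h => (arms h, pi t h)) f).
  move=> [s a].
  rewrite (_ : [set _ | _] = (\bigcap_(i in [set: 'I_t])
     ((fun h : history t => (tnth h i).1) @^-1` [set tnth s i])) `&`
     (pi t @^-1` [set a])); last first.
    apply/seteqP; split => h /=.
      by move=> [<- <-]; split => // i _ /=; rewrite tnth_map.
    move=> [hs <-]; congr pair; apply: eq_from_tnth => i.
    by rewrite tnth_map; exact: hs.
  apply: measurableI; last first.
    by rewrite -[X in measurable X]setTI; exact: measurable_funPT.
  apply: fin_bigcap_measurable => [|i _]; first exact: finite_finset.
  rewrite -[X in measurable X]setTI.
  exact: (measurableT_comp measurable_fst (measurable_tnth i)).
move=> [s a]; rewrite /f /=.
have mA : measurable ((fun hx => @extend t a hx.1 hx.2) @^-1` U).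
  by rewrite -[X in measurable X]setTI; exact: measurable_uncurry_extend.
have := measurable_fun_xsection (nu a (triggers (rcons s a) a)) mA.
apply: eq_measurable_fun => h _ /=.
by rewrite xsectionE.
Qed.

HB.instance Definition _ t := isKernel.Build _ _ _ _ _ (@round_kernel t)
  (@measurable_round t).

Let round_setT t (h : history t) : round_kernel h [set: history t.+1] = 1%E.
Proof. exact: probability_setT. Qed.

HB.instance Definition _ t := Kernel_isProbability.Build _ _ _ _ _
  (@round_kernel t) (@round_setT t).

Fixpoint law (t : nat) : probability (history t) R :=
  if t is t'.+1 then kbind (law t') (@round_kernel t') else \d_[tuple].

End law.

Definition J (T : nat) (pi : policy) : \bar R :=
  'E_(law pi T)[fun h => \sum_(s < T)
    let i := tnth (arms h) s in mu i (triggers (take s.+1 (arms h)) i)].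

(* The policy playing arm a t in round t, whatever the history. *)
Definition round_policy (a : nat -> arm) : policy := fun t => cst (a t.+1).

(* All means being nonnegative, the default value 0 is harmless when C is
   nonempty. *)
Definition clique_max (C : {set arm}) (t : nat) : R :=
  \big[Num.max/0]_(j in C) mu j t.

End graph_triggered_bandit.

(* Main.v *)
(* Pulling any arm of a clique C triggers all of C, so the n-th pull inside C
   earns at most M_C(n) = max_{j in C} mu_j(n). A run of T rounds pulling each C
   exactly n_C times thus earns at most the sum over C of S_C(n_C), where
   S_C(m) = M_C(1) + ... + M_C(m). Rewards being rising, M_C is nondecreasing,
   so T S_C(n_C) <= n_C S_C(T) <= n_C S_{C*}(T); summing over C, with
   sum_C n_C = T, bounds every run by S_{C*}(T). The policy pi* plays in C* only,
   hence almost surely earns exactly S_{C*}(T). *)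
Require Import Defs.
From mathcomp Require Import all_boot all_order all_algebra.
From mathcomp Require Import all_classical all_reals all_analysis.
From mathcomp Require Import measurable_realfun.
Import Order.TTheory GRing.Theory Num.Theory.
Import numFieldNormedType.Exports.
Local Open Scope classical_set_scope.
Local Open Scope ring_scope.

(** Prefix averages of a nondecreasing sequence grow with the length; cross-multiplying avoids
    division. *)
Lemma prefix_sum_le_average {R : numDomainType} (f : nat -> R) (m n : nat) :
  {in [pred i | 0 < i]%N &, {homo f : i j / (i <= j)%N >-> i <= j}} ->
  (m <= n)%N ->
  (\sum_(1 <= t < m.+1) f t) *+ n <= (\sum_(1 <= t < n.+1) f t) *+ m.
Proof.
move=> f_mono; elim: n => [|n IHn]; first by rewrite leqn0 => /eqP->.
rewrite leq_eqVlt => /predU1P[-> //|m_le_n].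
(* The left side gains the terms [f 1], ..., [f m], the right side [m] copies of the larger
   [f n.+1]. *)
rewrite mulrSr [in leRHS]big_nat_recr//= mulrnDl lerD ?IHn//.
apply: (@le_trans _ _ (\sum_(1 <= t < m.+1) f n.+1)); last first.
  by rewrite sumr_const_nat subn1.
rewrite !big_nat; apply: ler_sum => t /andP[t_gt0 t_le_m].
by rewrite f_mono// (leq_trans _ m_le_n)// ltnW.
Qed.

(** * Expected rewards reduced to rewards of arm sequences *)

Section policy_values.
Context {R : realType} {k : nat}.
Local Notation arm := 'I_k.+1.
Local Notation history t := (t.-tuple (arm * measurableTypeR R)).
Variable nu : arm -> nat -> probability (measurableTypeR R) R.
Variable G : 'M[bool]_k.+1.

(** The summed means depend on the pulled arms alone; a plain [seq] allows induction on the last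
    pull. *)
Definition path_reward (s : seq arm) : R :=
  \sum_(p < size s) mu nu (nth ord0 s p) (triggers G (take p.+1 s) (nth ord0 s p)).

Lemma path_reward_rcons s a :
  path_reward (rcons s a) = path_reward s + mu nu a (triggers G (rcons s a) a).
Proof.
rewrite /path_reward size_rcons big_ord_recr/= nth_rcons ltnn eqxx.
rewrite take_oversize ?size_rcons//; congr +%R.
apply: eq_bigr => p _; rewrite nth_rcons ltn_ord.
by rewrite -cats1 takel_cat.
Qed.

Lemma triggers_rcons s a i :
  triggers G (rcons s a) i = (triggers G s i + G a i)%N.
Proof. by rewrite /triggers -cats1 big_cat big_seq1. Qed.

Lemma triggers_gt0 s a : G a a -> (0 < triggers G (rcons s a) a)%N.
Proof. by move=> Gaa; rewrite triggers_rcons Gaa addn1. Qed.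

Lemma path_reward_ge0 s : bounded_means nu -> (forall i, G i i) ->
  0 <= path_reward s.
Proof.
move=> nuB Gii; elim/last_ind: s => [|s a IHs].
  by rewrite /path_reward big_ord0.
rewrite path_reward_rcons addr_ge0//.
by have [_ /andP[]] := nuB a _ (triggers_gt0 s a (Gii a)).
Qed.

Lemma J_path_reward T (pi : policy) :
  J nu G T pi = (\int[law nu G pi T]_h (path_reward (arms h))%:E)%E.
Proof.
rewrite /J unlock; apply: eq_integral => h _; congr EFin.
rewrite /path_reward size_tuple; apply: eq_bigr => p _ /=.
by rewrite -tnth_nth.
Qed.

Lemma measurable_arms_eq {t} (s : t.-tuple arm) :
  measurable [set h : history t | arms h = s].
Proof.
rewrite (_ : [set _ | _] = \bigcap_(i in [set: 'I_t])
     ((fun h : history t => (tnth h i).1) @^-1` [set tnth s i])); last first.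
  apply/seteqP; split => h /=; first by move=> <- i _ /=; rewrite tnth_map.
  by move=> hs; apply: eq_from_tnth => i; rewrite tnth_map; exact: hs.
apply: fin_bigcap_measurable => [|i _]; first exact: finite_finset.
rewrite -[X in measurable X]setTI.
exact: (measurableT_comp measurable_fst (measurable_tnth i)).
Qed.

Lemma measurable_path_reward t :
  measurable_fun setT (fun h : history t => (path_reward (arms h))%:E).
Proof.
apply/measurable_EFinP.
apply: (measurable_discrete_choice
  (c := @arms R k t) (f := fun (s : t.-tuple arm) _ => path_reward s)) => // s.
exact: measurable_arms_eq.
Qed.

Lemma J_le T (pi : policy) (c : R) : bounded_means nu -> (forall i, G i i) ->
  (forall s : T.-tuple arm, path_reward s <= c) -> (J nu G T pi <= c%:E)%E.
Proof.
move=> nuB Gii path_le; rewrite J_path_reward.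
apply: (@le_trans _ _ (\int[law nu G pi T]_h (cst c%:E h))%E).
  apply: ge0_le_integral => //.
  - by move=> h _; rewrite lee_fin path_reward_ge0.
  - exact: measurable_path_reward.
  - by move=> h _; rewrite lee_fin path_le.
rewrite integral_cst// (_ : _ setT = 1%E) ?mule1//; exact: probability_setT.
Qed.

(** By induction, since each round kernel sends a prescribed run almost surely to its prescribed
    extension. *)
Lemma law_round_policy (a : nat -> arm) t :
  law nu G (round_policy a) t
    [set h | arms h = [tuple of mkseq (fun i => a i.+1) t]] = 1%E.
Proof.
elim: t => [|t IHt] /=.
  rewrite diracE mem_set//; exact: val_inj.
apply/eqP; rewrite eq_le probability_le1 ?andTb; last exact: measurable_arms_eq.
(* The 1 becomes the integral of the indicator of the prescribed prefix, a pointwise lower bound for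
   the kernel. *)
rewrite -[leLHS]IHt -[X in law nu G _ t X]setIT -integral_indic//; last first.
  exact: measurable_arms_eq.
apply: ge0_le_integral => //.
- apply/measurable_EFinP/measurable_indic; exact: measurable_arms_eq.
- exact: (measurable_kernel (round_kernel nu G (round_policy a) (t := t)) _
    (measurable_arms_eq _)).
move=> h _; rewrite indicE; have [/set_mem hE|_] := boolP (h \in _); last first.
  exact: measure_ge0.
rewrite /round_kernel/= /distribution /pushforward.
(* Whatever the new reward, the extended history has the prescribed arms. *)
rewrite (_ : _ @^-1` _ = setT) ?probability_setT//.
apply/seteqP; split => // x _ /=.
apply: val_inj; rewrite /= mkseqS map_rcons/=; congr rcons.
exact: (congr1 val hE).
Qed.

(** Rewards of runs being nonnegative, the integral may be restricted to the event of the prescribed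
    run, which has mass 1. *)
Lemma path_reward_le_J (a : nat -> arm) T : bounded_means nu -> (forall i, G i i) ->
  ((path_reward (mkseq (fun i => a i.+1) T))%:E <= J nu G T (round_policy a))%E.
Proof.
move=> nuB Gii; rewrite J_path_reward.
set s := [tuple of mkseq (fun i => a i.+1) T].
have mE : measurable [set h : history T | arms h = s].
  exact: measurable_arms_eq.
apply: (@le_trans _ _
  (\int[law nu G (round_policy a) T]_(h in [set h | arms h = s])
    (path_reward (arms h))%:E)%E); last first.
  apply: ge0_subset_integral => //; first exact: measurable_path_reward.
  by move=> h _; rewrite lee_fin path_reward_ge0.
rewrite (eq_integral (cst (path_reward s)%:E)) => [|h /set_mem/= hE]; last first.
  exact: (congr1 (fun u : T.-tuple arm => (path_reward u)%:E) hE).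
rewrite integral_cst// -[leLHS]mule1 -(law_round_policy a T); exact: lexx.
Qed.

End policy_values.

(** * Rewards counted clique by clique *)

Section cliques.
Context {R : realType} {k : nat}.
Local Notation arm := 'I_k.+1.
Variable nu : arm -> nat -> probability (measurableTypeR R) R.

Lemma mu_homo i : rising nu ->
  {in [pred n | 0 < n]%N &, {homo mu nu i : m n / (m <= n)%N >-> m <= n}}.
Proof.
move=> nuR; apply: homo_leq_in => [//|x y z|m n Dm _ p /andP[mp _]|n Dn _].
- exact: le_trans.
- by rewrite inE (leq_trans _ mp).
- by rewrite -subr_ge0; exact: (nuR i).1.
Qed.

Lemma clique_max_homo C : rising nu ->
  {in [pred n | 0 < n]%N &, {homo clique_max nu C : m n / (m <= n)%N >-> m <= n}}.
Proof. by move=> nuR m n Dm Dn mn; apply: le_bigmax2 => j _; exact: mu_homo. Qed.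

Lemma mu_le_clique_max (C : {set arm}) j n : j \in C -> mu nu j n <= clique_max nu C n.
Proof. exact: le_bigmax_cond. Qed.

(** Nonnegative means keep the default 0 of the maximum from exceeding the true one. *)
Lemma clique_max_argmax (C : {set arm}) j n : bounded_means nu -> (0 < n)%N ->
  argmax [set` C] (fun j => mu nu j n) j -> clique_max nu C n = mu nu j n.
Proof.
move=> nuB n_gt0 [Cj jmax]; apply/le_anti; rewrite mu_le_clique_max// andbT.
by apply: bigmax_le => //; have [_ /andP[]] := nuB j n n_gt0.
Qed.

Variables (G : 'M[bool]_k.+1) (CG : {set {set arm}}).
Hypothesis G_clique : clique_partition G CG.

Lemma mem_clique C a : C \in CG -> (a \in C) = (C == finset.pblock CG a).
Proof.
have [/and3P[/eqP covCG trivCG _] _] := G_clique => CGC.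
have [aC|aNC] := boolP (a \in C).
  by rewrite (def_pblock trivCG CGC aC) eqxx.
apply/esym/negbTE; apply: contra aNC => /eqP->.
by rewrite mem_pblock covCG inE.
Qed.

Lemma pblock_clique a : finset.pblock CG a \in CG.
Proof.
have [/and3P[/eqP covCG _ _] _] := G_clique.
by rewrite pblock_mem// covCG inE.
Qed.

Lemma triggers_count s i C : C \in CG -> i \in C ->
  triggers G s i = count (mem C) s.
Proof.
move=> CGC; rewrite mem_clique// => /eqP CE.
rewrite /triggers -sum1_count [RHS]big_mkcond/=; apply: eq_bigr => j _.
by rewrite G_clique.2 mem_clique// CE eq_sym; case: eqP.
Qed.

Lemma sum_count_clique (s : seq arm) :
  (\sum_(C in CG) count (mem C) s)%N = size s.
Proof.
elim: s => [|a s IHs] /=; first by rewrite big1.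
rewrite big_split/= IHs (bigD1 (finset.pblock CG a)) ?pblock_clique//=.
rewrite mem_clique ?pblock_clique// eqxx big1 ?addn0 ?add1n// => C /andP[CGC].
by rewrite mem_clique// => /negbTE->.
Qed.

(** A last pull of [a] adds one term to the prefix sum of the clique of [a] and leaves the other
    cliques unchanged. *)
Lemma path_reward_le_cliques s :
  path_reward nu G s <=
  \sum_(C in CG) \sum_(1 <= t < (count (mem C) s).+1) clique_max nu C t.
Proof.
elim/last_ind: s => [|s a IHs].
  by rewrite /path_reward big_ord0 sumr_ge0// => C _; rewrite big_nil.
rewrite path_reward_rcons.
have CGa := pblock_clique a.
have aCa : a \in finset.pblock CG a by rewrite mem_clique.
rewrite (bigD1 (finset.pblock CG a))//= in IHs; rewrite (bigD1 (finset.pblock CG a))//=.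
rewrite (eq_bigr (fun C : {set arm} =>
  \sum_(1 <= t < (count (mem C) s).+1) clique_max nu C t)); last first.
  move=> C /andP[CGC]; rewrite -cats1 count_cat /= mem_clique//.
  by move=> /negbTE->; rewrite !addn0.
(* The trigger number counts the current pull too, so it is exactly the index of the added term. *)
rewrite (triggers_count _ _ _ CGa aCa) -cats1 count_cat /= aCa addn0 addn1.
rewrite big_nat_recr//= addrAC lerD//.
exact: mu_le_clique_max.
Qed.

Lemma path_reward_le_best s (Cstar : {set arm}) : rising nu ->
  argmax [set` CG] (fun C : {set arm} =>
    \sum_(1 <= t < (size s).+1) clique_max nu C t) Cstar ->
  path_reward nu G s <= \sum_(1 <= t < (size s).+1) clique_max nu Cstar t.
Proof.
move=> nuR [_ Cstar_max].
have [->|s_neq0] := eqVneq s [::].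
  by rewrite /path_reward big_ord0 big_nil.
have T_gt0 : (0 < size s)%N by case: (s) s_neq0.
rewrite -(ler_pMn2r T_gt0).
apply: le_trans (ler_wMn2r _ (path_reward_le_cliques s)) _.
(* The factor [size s] on the right is split into the pull counts of the cliques, to compare clique
   by clique. *)
rewrite -sumrMnl -[X in _ <= _ *+ X]sum_count_clique -sumrMnr.
apply: ler_sum => C CGC.
apply: le_trans (prefix_sum_le_average _ _ _ (clique_max_homo C nuR) (count_size _ _)) _.
by apply: ler_wMn2r; exact: Cstar_max.
Qed.

(** As every pull lies in [C], the arm pulled in round [t] is at its [t]-th trigger, where its mean
    attains the clique maximum. *)
Lemma path_reward_clique_policy (C : {set arm}) (a : nat -> arm) T :
  bounded_means nu -> C \in CG ->
  (forall t, (1 <= t <= T)%N -> argmax [set` C] (fun j => mu nu j t) (a t)) ->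
  path_reward nu G (mkseq (fun i => a i.+1) T) =
  \sum_(1 <= t < T.+1) clique_max nu C t.
Proof.
move=> nuB CGC aC.
have {}aC t (tT : (t < T)%N) := aC t.+1 tT.
elim: T aC => [|T IHT] aC; first by rewrite /path_reward big_ord0 big_nil.
rewrite mkseqS path_reward_rcons IHT => [|t tT]; last by apply: aC; rewrite ltnW.
rewrite [RHS]big_nat_recr//=; congr +%R.
have aTC := aC T (ltnSn T).
rewrite (clique_max_argmax _ _ _ nuB _ aTC)//; congr mu.
rewrite (triggers_count _ _ _ CGC aTC.1) -mkseqS -[RHS](size_mkseq (fun i => a i.+1)).
apply/eqP; rewrite -all_count; apply/allP => _ /mapP[t + ->].
by rewrite mem_iota => /andP[_ tT]; exact: (aC t tT).1.
Qed.

End cliques.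

Theorem theorem2 (R : realType) (k kt T : nat)
    (nu : 'I_k.+1 -> nat -> probability (measurableTypeR R) R)
    (G : 'M[bool]_k.+1) (CG : {set {set 'I_k.+1}})
    (Cstar : {set 'I_k.+1}) (pistar : nat -> 'I_k.+1) :
  bounded_means nu -> rising nu ->
  connectivity G -> clique_partition G CG -> #|CG| = kt ->
  argmax [set` CG]
    (fun C : {set 'I_k.+1} => \sum_(1 <= t < T.+1) clique_max nu C t) Cstar ->
  (forall t, (1 <= t <= T)%N ->
    argmax [set` Cstar] (fun j => mu nu j t) (pistar t)) ->
  argmax [set: policy] (J nu G T) (round_policy pistar).
Proof.
move=> nuB nuR [_ Gii] G_clique _ Cstar_max pistarP; split=> // pi _.
(* The reward of the prescribed run separates the two values: it is at most the value of [pistar]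
   and bounds every run of [pi]. *)
apply: le_trans (path_reward_le_J nu G pistar T nuB Gii).
rewrite (path_reward_clique_policy nu G CG G_clique Cstar)//; last exact: Cstar_max.1.
apply: J_le => // s; rewrite -{2}(size_tuple s).
by apply: (path_reward_le_best nu G CG) => //; rewrite size_tuple.
Qed.
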